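(* Let $\varphi$ be a $C^1$-process on $\mathbb{I}$, $x\in\mathbb{R}^n$, let $\varphi(\cdot,t_-,x)$ be an attractive (respectively repulsive) trajectory, and let $m$ (taken with respect to the reference trajectory $\varphi(\cdot,t_-,x)$) be continuous at $0$. Then there exists a neighborhood $U$ of $x$ such that $U\subseteq W^{\mathrm s}_x$ (respectively $U\subseteq W^{\mathrm u}_x$).
   Context: Let $n\ge 1$, let $|\cdot|$ be an arbitrary fixed norm on $\mathbb{R}^n$ with unit sphere $\mathcal{S}$, closed balls $B[0,\delta]$ and induced operator norm $\|\cdot\|$. Let $\mathbb{I}\subset\mathbb{R}$ be compact (not necessarily an interval), $t_-=\min\mathbb{I}<t_+=\max\mathbb{I}$. Put $\mathbb{I}^2_{\neq}=\{(t,s)\in\mathbb{I}\times\mathbb{I}: t\neq s\}$ with closure $\overline{\mathbb{I}^2_{\neq}}$ in $\mathbb{R}^2$. A process on $\mathbb{I}$ is a continuous map $\varphi:\mathbb{I}\times\mathbb{I}\times\mathbb{R}^n\to\mathbb{R}^n$, $(t,s,x)\mapsto\varphi(t,s,x)$, Lipschitz continuous in the first argument, with $\varphi(t,t,\cdot)=\mathrm{id}$ and $\varphi(t,s,\cdot)\circ\varphi(s,r,\cdot)=\varphi(t,r,\cdot)$ for all $t,s,r\in\mathbb{I}$. It is a $C^k$-process ($k\ge1$) if $\varphi(t,s,\cdot)\in C^k(\mathbb{R}^n,\mathbb{R}^n)$ for all $t,s$ and the space derivative $t\mapsto\partial_x\varphi(t,s,x)$ is Lipschitz continuous for all $s,x$.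 A linear process is a process $\Phi(t,s,x)=\Phi(t,s)x$ with $\Phi(t,s)\in GL(n,\mathbb{R})$ and $t\mapsto\Phi(t,s)$ Lipschitz continuous in operator norm. For continuous $f:\mathbb{I}\to(0,\infty)$ let $\Delta(f)(t,s)=\frac{\ln f(t)-\ln f(s)}{t-s}$, $(t,s)\in\mathbb{I}^2_{\neq}$. Standing assumption: $\mathcal{LP}(\mathbb{I},\mathbb{R}^n)$ is the set of linear processes $\Phi$ for which $(x,t,s)\mapsto\Delta(|\Phi(\cdot,t_-)x|)(t,s)$ extends continuously from $\mathcal{S}\times\mathbb{I}^2_{\neq}$ to $\mathcal{S}\times\overline{\mathbb{I}^2_{\neq}}$ (same symbol for the extension); linearizations are assumed to belong to $\mathcal{LP}(\mathbb{I},\mathbb{R}^n)$. For $\Phi\in\mathcal{LP}(\mathbb{I},\mathbb{R}^n)$, $\underline{\lambda}(\mathbb{R}^n,\Phi)$ and $\overline{\lambda}(\mathbb{R}^n,\Phi)$ are the minimum and maximum of $\Delta(|\Phi(\cdot,t_-)y|)(t,s)$ over $y\in\mathcal{S}$, $(t,s)\in\overline{\mathbb{I}^2_{\neq}}$. $\Phi$ is (finite-time) attractive if $\overline{\lambda}(\mathbb{R}^n,\Phi)<0$ and repulsive if $\underline{\lambda}(\mathbb{R}^n,\Phi)>0$ (these are the cases $k=n$ and $k=0$ of an exponential monotonicity dichotomy). The linearization of $\varphi$ along $\varphi(\cdot,t_-,x)$ is $\Phi_{(t_-,x)}(t,s)=\partial_x\varphi(t,s,\varphi(s,t_-,x))$.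 The trajectory $\varphi(\cdot,t_-,x)$ is called attractive/repulsive if $\Phi_{(t_-,x)}$ is. Function $m$ for the reference trajectory $\varphi(\cdot,t_-,x)$: shifting the reference trajectory to zero, let $\tilde\varphi(t,s,z)=\varphi(t,s,z+\varphi(s,t_-,x))-\varphi(t,t_-,x)$, whose linearization along its zero trajectory is $\Phi:=\Phi_{(t_-,x)}$. For $z\neq0$ and $\psi\in\{\tilde\varphi,\Phi\}$ put $\underline{\mu}(z,\psi)=\inf_{(t,s)\in\mathbb{I}^2_{\neq}}\Delta(|\psi(\cdot,t_-,z)|)(t,s)$ and $\overline{\mu}(z,\psi)=\sup_{(t,s)\in\mathbb{I}^2_{\neq}}\Delta(|\psi(\cdot,t_-,z)|)(t,s)$. Define $m(0)=0$ and, for $r>0$, $$m(r)=\sup_{z\in B[0,r]\setminus\{0\}}\max\{|\underline{\mu}(z,\tilde\varphi)-\underline{\mu}(z,\Phi)|,|\overline{\mu}(z,\tilde\varphi)-\overline{\mu}(z,\Phi)|\}\in[0,\infty].$$ Domains of attraction and repulsion: $$W^{\mathrm s}_x=\Big\{y\neq x:\sup_{(t,s)\in\mathbb{I}^2_{\neq}}\Delta(|\varphi(\cdot,t_-,y)-\varphi(\cdot,t_-,x)|)(t,s)<0\Big\}\cup\{x\},$$ $$W^{\mathrm u}_x=\Big\{y\neq x:\inf_{(t,s)\in\mathbb{I}^2_{\neq}}\Delta(|\varphi(\cdot,t_-,y)-\varphi(\cdot,t_-,x)|)(t,s)>0\Big\}\cup\{x\}.$$ *)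

(* Defs.v *)
From HB Require Import structures.
From mathcomp Require Export all_boot all_order all_algebra.
From mathcomp Require Export all_classical all_reals all_analysis.
Export Order.TTheory GRing.Theory Num.Theory.
Export numFieldNormedType.Exports.

Set Implicit Arguments.
Unset Strict Implicit.
Unset Printing Implicit Defensive.

Local Open Scope classical_set_scope.
Local Open Scope ring_scope.

(* R^n is 'rV[R]_n with the topology of the library; all norms of R^n induce it.
   Vectors are rows, so a matrix A stands for the linear map x |-> x *m A, as
   with the library's jacobian. *)

Definition is_norm (R : realType) (n : nat) (N : 'rV[R]_n -> R) : Prop :=
  [/\ forall x y, N (x + y) <= N x + N y,
      forall (a : R) x, N (a *: x) = `|a| * N x &
      forall x, N x = 0 -> x = 0].

Definition unit_sphere (R : realType) (n : nat) (N : 'rV[R]_n -> R) :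
  set 'rV[R]_n := [set x | N x = 1].

Definition op_norm (R : realType) (n : nat) (N : 'rV[R]_n -> R)
  (A : 'M[R]_n) : R := sup [set N (x *m A) | x in unit_sphere N].

Definition lipschitz_wrt (R : realType) (V : zmodType) (M : V -> R)
  (I : set R) (f : R -> V) : Prop :=
  exists L : R, forall t s, I t -> I s -> M (f t - f s) <= L * `|t - s|.

Definition offdiag (R : realType) (I : set R) : set (R * R) :=
  [set p | [/\ I p.1, I p.2 & p.1 <> p.2]].

(* phi t s x is only relevant for t and s in I. *)
Definition is_process (R : realType) (n : nat) (N : 'rV[R]_n -> R)
  (I : set R) (phi : R -> R -> 'rV[R]_n -> 'rV[R]_n) : Prop :=
  [/\ {within [set p : R * R * 'rV[R]_n | I p.1.1 /\ I p.1.2],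
        continuous (fun p => phi p.1.1 p.1.2 p.2)},
      forall s x, I s -> lipschitz_wrt N I (fun t => phi t s x),
      forall t x, I t -> phi t t x = x &
      forall t s r x, I t -> I s -> I r ->
        phi t s (phi s r x) = phi t r x].

Definition is_C1_process (R : realType) (n : nat) (N : 'rV[R]_n -> R)
  (I : set R) (phi : R -> R -> 'rV[R]_n -> 'rV[R]_n) : Prop :=
  [/\ is_process N I phi,
      forall t s, I t -> I s ->
        (forall x, differentiable (phi t s) x) /\
        continuous (jacobian (phi t s)) &
      forall s x, I s ->
        lipschitz_wrt (op_norm N) I (fun t => jacobian (phi t s) x)].

Definition flow_of (R : realType) (n : nat) (Phi : R -> R -> 'M[R]_n) :
  R -> R -> 'rV[R]_n -> 'rV[R]_n := fun t s x => x *m Phi t s.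

Definition is_linear_process (R : realType) (n : nat) (N : 'rV[R]_n -> R)
  (I : set R) (Phi : R -> R -> 'M[R]_n) : Prop :=
  [/\ is_process N I (flow_of Phi),
      forall t s, I t -> I s -> Phi t s \in unitmx &
      forall s, I s -> lipschitz_wrt (op_norm N) I (fun t => Phi t s)].

Definition Delta (R : realType) (f : R -> R) (p : R * R) : R :=
  (ln (f p.1) - ln (f p.2)) / (p.1 - p.2).

Definition is_Delta_extension (R : realType) (n : nat) (N : 'rV[R]_n -> R)
  (I : set R) (tm : R) (Phi : R -> R -> 'M[R]_n)
  (g : 'rV[R]_n * (R * R) -> R) : Prop :=
  {within unit_sphere N `*` closure (offdiag I), continuous g} /\
  (forall x p, unit_sphere N x -> offdiag I p ->
    g (x, p) = Delta (fun t => N (flow_of Phi t tm x)) p).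

Definition in_LP (R : realType) (n : nat) (N : 'rV[R]_n -> R)
  (I : set R) (tm : R) (Phi : R -> R -> 'M[R]_n) : Prop :=
  is_linear_process N I Phi /\ exists g, is_Delta_extension N I tm Phi g.

(* For Phi in LP the extension is unique on the set where it is used below. *)
Definition Delta_ext (R : realType) (n : nat) (N : 'rV[R]_n -> R)
  (I : set R) (tm : R) (Phi : R -> R -> 'M[R]_n) : 'rV[R]_n * (R * R) -> R :=
  get [set g | is_Delta_extension N I tm Phi g].

(* For Phi in LP (and n >= 1) these are attained: the image is compact and
   nonempty. *)
Definition lambda_lower (R : realType) (n : nat) (N : 'rV[R]_n -> R)
  (I : set R) (tm : R) (Phi : R -> R -> 'M[R]_n) : R :=
  inf (Delta_ext N I tm Phi @` (unit_sphere N `*` closure (offdiag I))).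

Definition lambda_upper (R : realType) (n : nat) (N : 'rV[R]_n -> R)
  (I : set R) (tm : R) (Phi : R -> R -> 'M[R]_n) : R :=
  sup (Delta_ext N I tm Phi @` (unit_sphere N `*` closure (offdiag I))).

Definition attractive (R : realType) (n : nat) (N : 'rV[R]_n -> R)
  (I : set R) (tm : R) (Phi : R -> R -> 'M[R]_n) : Prop :=
  lambda_upper N I tm Phi < 0.

Definition repulsive (R : realType) (n : nat) (N : 'rV[R]_n -> R)
  (I : set R) (tm : R) (Phi : R -> R -> 'M[R]_n) : Prop :=
  0 < lambda_lower N I tm Phi.

Definition linearization (R : realType) (n : nat) (tm : R)
  (phi : R -> R -> 'rV[R]_n -> 'rV[R]_n) (x : 'rV[R]_n) :
  R -> R -> 'M[R]_n := fun t s => jacobian (phi t s) (phi s tm x).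

Definition attractive_trajectory (R : realType) (n : nat) (N : 'rV[R]_n -> R)
  (I : set R) (tm : R) (phi : R -> R -> 'rV[R]_n -> 'rV[R]_n)
  (x : 'rV[R]_n) : Prop := attractive N I tm (linearization tm phi x).

Definition repulsive_trajectory (R : realType) (n : nat) (N : 'rV[R]_n -> R)
  (I : set R) (tm : R) (phi : R -> R -> 'rV[R]_n -> 'rV[R]_n)
  (x : 'rV[R]_n) : Prop := repulsive N I tm (linearization tm phi x).

Definition inf_Delta (R : realType) (I : set R) (f : R -> R) : \bar R :=
  ereal_inf [set (Delta f p)%:E | p in offdiag I].

Definition sup_Delta (R : realType) (I : set R) (f : R -> R) : \bar R :=
  ereal_sup [set (Delta f p)%:E | p in offdiag I].

Definition mu_lower (R : realType) (n : nat) (N : 'rV[R]_n -> R)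
  (I : set R) (tm : R) (psi : R -> R -> 'rV[R]_n -> 'rV[R]_n)
  (z : 'rV[R]_n) : \bar R := inf_Delta I (fun t => N (psi t tm z)).

Definition mu_upper (R : realType) (n : nat) (N : 'rV[R]_n -> R)
  (I : set R) (tm : R) (psi : R -> R -> 'rV[R]_n -> 'rV[R]_n)
  (z : 'rV[R]_n) : \bar R := sup_Delta I (fun t => N (psi t tm z)).

Definition shifted (R : realType) (n : nat) (tm : R)
  (phi : R -> R -> 'rV[R]_n -> 'rV[R]_n) (x : 'rV[R]_n) :
  R -> R -> 'rV[R]_n -> 'rV[R]_n :=
  fun t s z => phi t s (z + phi s tm x) - phi t tm x.

(* The values at r < 0 are irrelevant. *)
Definition m_fun (R : realType) (n : nat) (N : 'rV[R]_n -> R)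
  (I : set R) (tm : R) (phi : R -> R -> 'rV[R]_n -> 'rV[R]_n)
  (x : 'rV[R]_n) (r : R) : \bar R :=
  let psi := shifted tm phi x in
  let Phi := flow_of (linearization tm phi x) in
  if r == 0 then 0%E else
  ereal_sup [set maxe `|mu_lower N I tm psi z - mu_lower N I tm Phi z|%E
                      `|mu_upper N I tm psi z - mu_upper N I tm Phi z|%E
            | z in [set z | N z <= r /\ z <> 0]].

Definition m_continuous_at0 (R : realType) (n : nat) (N : 'rV[R]_n -> R)
  (I : set R) (tm : R) (phi : R -> R -> 'rV[R]_n -> 'rV[R]_n)
  (x : 'rV[R]_n) : Prop :=
  m_fun N I tm phi x @ within [set r | 0 <= r] (nbhs (0 : R))
    --> m_fun N I tm phi x 0.

Definition W_s (R : realType) (n : nat) (N : 'rV[R]_n -> R)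
  (I : set R) (tm : R) (phi : R -> R -> 'rV[R]_n -> 'rV[R]_n)
  (x : 'rV[R]_n) : set 'rV[R]_n :=
  [set y | y <> x /\
    (sup_Delta I (fun t => N (phi t tm y - phi t tm x)%R) < 0)%E] `|` [set x].

Definition W_u (R : realType) (n : nat) (N : 'rV[R]_n -> R)
  (I : set R) (tm : R) (phi : R -> R -> 'rV[R]_n -> 'rV[R]_n)
  (x : 'rV[R]_n) : set 'rV[R]_n :=
  [set y | y <> x /\
    (0 < inf_Delta I (fun t => N (phi t tm y - phi t tm x)%R))%E] `|` [set x].

(* Main.v *)
Require Import Defs.
From mathcomp Require Import ring lra.

Set Implicit Arguments.
Unset Strict Implicit.
Unset Printing Implicit Defensive.

Local Open Scope classical_set_scope.
Local Open Scope ring_scope.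

(** Scaling z by a positive constant adds a constant to ln |Phi(t, t_-) z|,
    which cancels in difference quotients. So every difference quotient along a
    nonzero solution of the linearization is one along a solution that starts
    on the unit sphere, and both bounds mu(z, Phi) lie between the spectral
    bounds lambda_lower and lambda_upper, uniformly in z <> 0
    ([mu_upper_linear_le], [mu_lower_linear_ge]).

    If the trajectory is attractive, put e := - lambda_upper > 0. Continuity of
    m at 0 gives a radius r with m(r) < e, that is, for 0 < |z| <= r the upper
    bounds of the shifted process and of the linearization differ by less than e
    ([m_fun_small]). Since mu_upper(z, Phi) <= - e, the bound for the shifted
    process is negative. Now z + x runs through a ball of the norm around x, and
    that ball is a neighborhood because every norm on row vectors is continuous
    at 0 ([is_norm_ball_nbhs]). The repulsive case is the same with lower bounds
    and e := lambda_lower. *)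

(** * Norms on row vectors *)

Section Norm.
Variables (R : realType) (n : nat) (N : 'rV[R]_n -> R).
Hypothesis N_norm : is_norm N.

Lemma is_norm0 : N 0 = 0.
Proof. by case: N_norm => _ NZ _; rewrite -(scale0r 0) NZ normr0 mul0r. Qed.

Lemma is_norm_ge0 z : 0 <= N z.
Proof.
case: N_norm => ND NZ _.
have := ND z (- z); rewrite subrr is_norm0 -scaleN1r NZ normrN normr1 mul1r.
by lra.
Qed.

Lemma is_norm_gt0 z : z <> 0 -> 0 < N z.
Proof.
case: N_norm => _ _ Nsep z0; rewrite lt_neqAle is_norm_ge0 andbT eq_sym.
by apply/eqP => /Nsep.
Qed.

Lemma is_norm_sum (J : Type) (s : seq J) (F : J -> 'rV[R]_n) :
  N (\sum_(j <- s) F j) <= \sum_(j <- s) N (F j).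
Proof.
case: N_norm => ND _ _.
elim: s => [|j s IH]; first by rewrite !big_nil is_norm0.
by rewrite !big_cons (le_trans (ND _ _))// lerD2l.
Qed.

Lemma is_norm_le_normr z :
  N z <= (\sum_(j < n) N (delta_mx 0 j)) * `|z|.
Proof.
case: N_norm => _ NZ _.
rewrite {1}(row_sum_delta z) (le_trans (is_norm_sum _ _))// mulr_suml.
apply: ler_sum => j _; rewrite NZ mulrC ler_wpM2l ?is_norm_ge0//.
rewrite /Num.norm/= mx_normrE.
exact: (le_bigmax _ (fun ij => `|z ij.1 ij.2|) (ord0, j)).
Qed.

Lemma is_norm_ball_nbhs (x : 'rV[R]_n) (r : R) : 0 < r ->
  nbhs x [set y | N (y - x) <= r].
Proof.
move=> r0; set C := \sum_(j < n) N (delta_mx 0 j).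
have C0 : 0 <= C by apply: sumr_ge0 => j _; exact: is_norm_ge0.
(* C may vanish (for n = 0), hence the 1 in the denominator. *)
have C1 : 0 < C + 1 by rewrite ltr_wpDl.
apply/nbhs_ballP; exists (r / (C + 1)); first by rewrite /= divr_gt0.
move=> y; rewrite -ball_normE/= distrC => /ltW yx.
rewrite (le_trans (is_norm_le_normr _))//.
rewrite (@le_trans _ _ ((C + 1) * (r / (C + 1))))//.
  by apply: ler_pM => //; rewrite lerDl.
by rewrite mulrC divfK// gt_eqF.
Qed.

End Norm.

(** * Logarithmic difference quotients of the linearization *)

Lemma DeltaZ (R : realType) (c : R) (f g : R -> R) (p : R * R) :
  0 < c -> 0 < f p.1 -> 0 < f p.2 ->
  g p.1 = c * f p.1 -> g p.2 = c * f p.2 -> Delta g p = Delta f p.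
Proof.
move=> c0 f1 f2 g1 g2; rewrite /Delta g1 g2 !lnM ?posrE//.
by congr (_ / _); ring.
Qed.

Section Linear.
Variables (R : realType) (n : nat) (N : 'rV[R]_n -> R) (I : set R) (tm : R).
Variable Phi : R -> R -> 'M[R]_n.
Hypotheses (N_norm : is_norm N) (Itm : I tm) (PhiLP : in_LP N I tm Phi).

Let Deltas := Delta_ext N I tm Phi @` (unit_sphere N `*` closure (offdiag I)).

(** Normalize z to y := z / |z|. Invertibility of Phi(t, t_-) keeps the solution
    through y away from 0, so that its logarithm splits off ln |z|, and on the
    sphere the extension agrees with the difference quotient. *)
Lemma Delta_linear_mem z p : z <> 0 -> offdiag I p ->
  Deltas (Delta (fun t => N (flow_of Phi t tm z)) p).
Proof.
move=> z0 Ip; have [I1 I2 _] := Ip.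
have [_ NZ Nsep] := N_norm; have [[_ Phi_unit _] exg] := PhiLP.
have [_ gE] : is_Delta_extension N I tm Phi (Delta_ext N I tm Phi).
  by case: exg => g; exact: getI.
have Nz := is_norm_gt0 N_norm z0.
pose y := (N z)^-1 *: z.
have Ny : unit_sphere N y.
  by rewrite /unit_sphere/= NZ gtr0_norm ?invr_gt0// mulVf// gt_eqF.
have y0 : y <> 0.
  by move=> y0; move: Ny; rewrite /unit_sphere/= y0 is_norm0// => /esym/eqP;
    rewrite oner_eq0.
have flow_gt0 t : I t -> 0 < N (flow_of Phi t tm y).
  move=> It; apply: is_norm_gt0 => //; rewrite /flow_of => yP; apply: y0.
  by rewrite -(mulmxK (Phi_unit t tm It Itm) y) yP mul0mx.
have flowE t : N (flow_of Phi t tm z) = N z * N (flow_of Phi t tm y).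
  rewrite /flow_of -scalemxAl NZ gtr0_norm ?invr_gt0//.
  by rewrite mulrA mulfV ?mul1r// gt_eqF.
exists (y, p); first by split => //; exact: subset_closure.
by rewrite gE//; apply/esym/(DeltaZ Nz); rewrite ?flowE//; exact: flow_gt0.
Qed.

Lemma mu_upper_linear_le z : lambda_upper N I tm Phi != 0 -> z <> 0 ->
  (mu_upper N I tm (flow_of Phi) z <= (lambda_upper N I tm Phi)%:E)%E.
Proof.
move=> l0 z0.
(* The supremum of an unbounded set is 0 by convention. *)
have [_ ubD] : has_sup Deltas.
  by apply: contrapT => /sup_out/eqP; apply/negP.
apply: ge_ereal_sup => _ [p Ip <-]; rewrite lee_fin.
exact/(ub_le_sup ubD)/Delta_linear_mem.
Qed.

Lemma mu_lower_linear_ge z : lambda_lower N I tm Phi != 0 -> z <> 0 ->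
  ((lambda_lower N I tm Phi)%:E <= mu_lower N I tm (flow_of Phi) z)%E.
Proof.
move=> l0 z0.
(* The infimum of an unbounded set is 0 by convention. *)
have [_ lbD] : has_inf Deltas.
  by apply: contrapT => /inf_out/eqP; apply/negP.
apply: le_ereal_inf_tmp => _ [p Ip <-]; rewrite lee_fin.
exact/(ge_inf lbD)/Delta_linear_mem.
Qed.

End Linear.

(** * Perturbation by the nonlinear process *)

Section ExtendedReals.
Variable R : realType.
Implicit Types (a b : \bar R) (l : R).
Local Open Scope ereal_scope.

(** Infinite values do no harm: a difference of extended reals with an infinite
    term is itself infinite, so the bound on the distance excludes it. *)
Lemma lte0_of_dist a b l : b <= l%:E -> `|a - b| < (- l)%:E -> a < 0.
Proof.
case: a b => [a| |] [b| |]//=; rewrite ?lee_fin ?lte_fin// => bl.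
by rewrite ltr_norml => /andP[_]; lra.
Qed.

Lemma gte0_of_dist a b l : l%:E <= b -> `|a - b| < l%:E -> 0 < a.
Proof.
case: a b => [a| |] [b| |]//=; rewrite ?lee_fin ?lte_fin// => bl.
by rewrite ltr_norml => /andP[+ _]; lra.
Qed.

End ExtendedReals.

Section MFun.
Variables (R : realType) (n : nat) (N : 'rV[R]_n -> R) (I : set R) (tm : R).
Variables (phi : R -> R -> 'rV[R]_n -> 'rV[R]_n) (x : 'rV[R]_n).

Let psi := shifted tm phi x.
Let Phi := flow_of (linearization tm phi x).

Lemma m_fun_small (e : R) : m_continuous_at0 N I tm phi x -> 0 < e ->
  exists2 r : R, 0 < r & forall z, N z <= r -> z <> 0 ->
    (`|mu_lower N I tm psi z - mu_lower N I tm Phi z| < e%:E)%E /\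
    (`|mu_upper N I tm psi z - mu_upper N I tm Phi z| < e%:E)%E.
Proof.
move=> m_cont e0.
have : nbhs (m_fun N I tm phi x 0) [set u : \bar R | (u < e%:E)%E].
  by rewrite /m_fun eqxx; exact: (@nbhs_open_ereal_lt _ _ (fun=> e)).
move=> /m_cont /nbhs_ballP[d /= d0 md].
exists (d / 2) => [|z Nz z0]; first by rewrite divr_gt0.
have r0 : 0 < d / 2 by rewrite divr_gt0.
have : (m_fun N I tm phi x (d / 2) < e%:E)%E.
  by apply: md; rewrite /= ?ltW// -ball_normE/= sub0r normrN gtr0_norm//; lra.
rewrite /m_fun gt_eqF// => /(le_lt_trans _) mlt.
by apply/andP; rewrite -gt_max; apply: mlt; apply: ereal_sup_ubound; exists z.
Qed.

Lemma shifted_init y t : phi tm tm x = x ->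
  psi t tm (y - x) = phi t tm y - phi t tm x.
Proof. by move=> phi0; rewrite /psi /shifted phi0 subrK. Qed.

End MFun.

Theorem theorem4p15 (R : realType) (n : nat) (n_ge1 : (1 <= n)%N)
    (N : 'rV[R]_n -> R) (N_norm : is_norm N)
    (I : set R) (I_compact : compact I) (tm tp : R)
    (tm_min : I tm /\ lbound I tm) (tp_max : I tp /\ ubound I tp)
    (tm_lt_tp : tm < tp)
    (phi : R -> R -> 'rV[R]_n -> 'rV[R]_n) (phi_C1 : is_C1_process N I phi)
    (x : 'rV[R]_n) (lin_LP : in_LP N I tm (linearization tm phi x))
    (m_cont : m_continuous_at0 N I tm phi x) :
  (attractive_trajectory N I tm phi x ->
     exists U : set 'rV[R]_n, nbhs x U /\ U `<=` W_s N I tm phi x) /\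
  (repulsive_trajectory N I tm phi x ->
     exists U : set 'rV[R]_n, nbhs x U /\ U `<=` W_u N I tm phi x).
Proof.
have [Itm _] := tm_min.
have phi0 : phi tm tm x = x by case: phi_C1 => -[_ _ + _] _ _; apply.
have shiftE y : (fun t => N (phi t tm y - phi t tm x)) =
    (fun t => N (shifted tm phi x t tm (y - x))).
  by apply/funext => t; rewrite shifted_init.
split=> hyp.
- have e0 : 0 < - lambda_upper N I tm (linearization tm phi x).
    by rewrite oppr_gt0.
  have [r r0 close] := m_fun_small m_cont e0.
  exists [set y | N (y - x) <= r]; split; first exact: is_norm_ball_nbhs.
  move=> y /= yr; have [->|/eqP yx] := eqVneq y x; [by right|left; split => //].
  have z0 : y - x <> 0 by move/subr0_eq.
  have [_ upper_close] := close _ yr z0.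
  rewrite shiftE; apply: lte0_of_dist upper_close.
  by apply: mu_upper_linear_le => //; rewrite lt_eqF.
- have [r r0 close] := m_fun_small m_cont hyp.
  exists [set y | N (y - x) <= r]; split; first exact: is_norm_ball_nbhs.
  move=> y /= yr; have [->|/eqP yx] := eqVneq y x; [by right|left; split => //].
  have z0 : y - x <> 0 by move/subr0_eq.
  have [lower_close _] := close _ yr z0.
  rewrite shiftE; apply: gte0_of_dist lower_close.
  by apply: mu_lower_linear_ge => //; rewrite gt_eqF.
Qed.
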